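(* Let $(R_1,f_1,g_1)$ and $(R_2,f_2,g_2)$ be two commutative Krasner $(m,n)$-hyperrings with nonzero scalar identities $1_{R_1}$ and $1_{R_2}$, and let $P_1$ be a proper hyperideal of $R_1$. Then the following are equivalent: (i) $P_1\times R_2$ is an $n$-ary $wsq$-primary hyperideal of $R_1\times R_2$. (ii) $P_1\times R_2$ is an $n$-ary $sq$-primary hyperideal of $R_1\times R_2$. (iii) $P_1$ is an $n$-ary $sq$-primary hyperideal of $R_1$.
   Context: Notation: $m,n\ge 2$; $a_i^j$ denotes the sequence $a_i,a_{i+1},\dots,a_j$ (empty if $j<i$), and $a^{(k)}$ denotes $a$ repeated $k$ times. An $m$-ary hyperoperation $f$ on $R$ assigns to every $m$-tuple a nonempty subset of $R$ (a singleton is identified with its element). For nonempty subsets, $f(A_1^m)=\bigcup\{f(a_1^m): a_i\in A_i\}$ and $g(A_1^n)=\{g(a_1^n): a_i\in A_i\}$; an element $x$ in an argument stands for $\{x\}$. A canonical $m$-ary hypergroup $(R,f)$: $f$ is associative and commutative; there is a unique $0\in R$ with $f(x,0^{(m-1)})=\{x\}$ for all $x$; each $x$ has a unique $-x$ with $0\in f(x,-x,0^{(m-2)})$; and $x\in f(x_1^m)$ implies $x_i\in f(x,-x_1,\dots,-x_{i-1},-x_{i+1},\dots,-x_m)$ for each $i$. A Krasner $(m,n)$-hyperring $(R,f,g)$: $(R,f)$ is a canonical $m$-ary hypergroup, $g:R^n\to R$ is associative ($n$-ary semigroup), $g$ is distributive over $f$ in each argument, i.e. $g(a_1^{i-1},f(x_1^m),a_{i+1}^n)=f(g(a_1^{i-1},x_1,a_{i+1}^n),\dots,g(a_1^{i-1},x_m,a_{i+1}^n))$,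 and $0$ is absorbing for $g$. Commutative means $g$ is symmetric in its arguments; a scalar identity $1$ satisfies $g(x,1^{(n-1)})=x$ for all $x$. The product $R_1\times R_2$ is the Krasner $(m,n)$-hyperring with $(f_1\times f_2)((a_1,b_1),\dots,(a_m,b_m))=\{(a,b): a\in f_1(a_1^m), b\in f_2(b_1^m)\}$ and $(g_1\times g_2)((x_1,y_1),\dots,(x_n,y_n))=(g_1(x_1^n),g_2(y_1^n))$, with scalar identity $(1_{R_1},1_{R_2})$. A hyperideal of $R$ is a nonempty $I\subseteq R$ that is an $m$-ary subhypergroup of $(R,f)$ (closed under $f$ and under $x\mapsto -x$) with $g(a_1^{i-1},I,a_{i+1}^n)\subseteq I$ for all $a_1^n\in R$ and all $i$. A proper hyperideal $Q$ is ($n$-ary) prime if $g(a_1^n)\in Q$ with $a_1^n\in R$ implies $a_i\in Q$ for some $i$. The radical $\mathbf{r}^{(m,n)}(I)$ of a hyperideal $I$ is the intersection of all prime hyperideals containing $I$ (equal to $R$ if there are none). A proper hyperideal $P$ of $R$ is $n$-ary $sq$-primary (strongly quasi-primary) if for all $r_1^n\in R$, $g(r_1^n)\in P$ implies $g(r_i^{(2)},1^{(n-2)})\in P$ or $g(r_1^{i-1},1,r_{i+1}^n)\in \mathbf{r}^{(m,n)}(P)$ for some $1\le i\le n$. It is $n$-ary $wsq$-primary (weakly strongly quasi-primary) if for all $r_1^n\in R$, $0\ne g(r_1^n)\in P$ implies $g(r_i^{(2)},1^{(n-2)})\in P$ or $g(r_1^{i-1},1,r_{i+1}^n)\in \mathbf{r}^{(m,n)}(P)$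 for some $1\le i\le n$. *)

(* Defs.v *)
From mathcomp Require Import all_boot all_fingroup.
From mathcomp Require Import boolp classical_sets.

Set Implicit Arguments.
Unset Strict Implicit.
Unset Printing Implicit Defensive.

Local Open Scope classical_set_scope.

(* An m-tuple x_1^m of elements of R is a function 'I_m -> R, so positions are
   numbered from 0. *)

Section Tuples.
Context {T : Type} {m : nat}.
Implicit Type i : 'I_m.

(* (s_0, ..., s_(k-1), d^(m-k)), where k = size s <= m *)
Definition pad (s : seq T) (d : T) : 'I_m -> T := fun k => nth d s k.

(* (x_0, ..., x_(i-1), y, x_(i+m), ..., x_(2m-2)); only the first 2m-1 terms of
   x matter. *)
Definition splice (x : nat -> T) i (y : T) : 'I_m -> T :=
  fun k => if (k < i)%N then x k else if k == i then y else x (k + m.-1)%N.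

(* (y, x_0, ..., x_(i-1), x_(i+1), ..., x_(m-1)) *)
Definition move_front (y : T) (x : 'I_m -> T) i : 'I_m -> T :=
  fun k => if val k == 0%N then y
           else if (k <= i)%N then x (ord_pred k) else x k.

Definition box (A : 'I_m -> set T) : set ('I_m -> T) :=
  [set a | forall k, A k (a k)].

Definition hlift (f : ('I_m -> T) -> set T) (A : 'I_m -> set T) : set T :=
  \bigcup_(a in box A) f a.

Definition glift (g : ('I_m -> T) -> T) (A : 'I_m -> set T) : set T :=
  g @` box A.

End Tuples.

Record canonical_hypergroup (m : nat) (R : Type) (f : ('I_m -> R) -> set R)
    (zero : R) (opp : R -> R) : Prop := CanonicalHypergroup {
  hyp_nonempty : forall x, f x !=set0;
  hyp_assoc : forall (x : nat -> R) (i j : 'I_m),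
    hlift f (splice (set1 \o x) i (f (fun l => x (i + l)%N))) =
    hlift f (splice (set1 \o x) j (f (fun l => x (j + l)%N)));
  hyp_comm : forall (x : 'I_m -> R) (s : {perm 'I_m}), f (x \o s) = f x;
  hyp_zero : unique (fun e => forall x, f (pad [:: x] e) = [set x]) zero;
  hyp_opp : forall x, unique (fun y => f (pad [:: x; y] zero) zero) (opp x);
  hyp_rev : forall (x : R) (a : 'I_m -> R) (i : 'I_m),
    f a x -> f (move_front x (opp \o a) i) (a i)
}.

Record is_krasner (m n : nat) (R : Type) (f : ('I_m -> R) -> set R)
    (g : ('I_n -> R) -> R) (zero : R) (opp : R -> R) : Prop := IsKrasner {
  kr_hypergroup : canonical_hypergroup f zero opp;
  kr_assoc : forall (x : nat -> R) (i j : 'I_n),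
    g (splice x i (g (fun l => x (i + l)%N))) =
    g (splice x j (g (fun l => x (j + l)%N)));
  kr_distr : forall (a : 'I_n -> R) (i : 'I_n) (x : 'I_m -> R),
    glift g [eta set1 \o a with i |-> f x] =
    f (fun k => g [eta a with i |-> x k]);
  kr_absorb : forall (a : 'I_n -> R) (i : 'I_n), g [eta a with i |-> zero] = zero
}.

Record krasner (m n : nat) : Type := Krasner {
  carrier :> Type;
  hadd : ('I_m -> carrier) -> set carrier;
  nmul : ('I_n -> carrier) -> carrier;
  kzero : carrier;
  kopp : carrier -> carrier;
  krasnerP : is_krasner hadd nmul kzero kopp
}.
Arguments hadd {m n} R : rename.
Arguments nmul {m n} R : rename.
Arguments kzero {m n} R : rename.
Arguments kopp {m n} R : rename.

Section Krasner.
Context {m n : nat}.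
Variable R : krasner m n.

Definition commutative_krasner : Prop :=
  forall (x : 'I_n -> R) (s : {perm 'I_n}), nmul R (x \o s) = nmul R x.

Definition scalar_identity (one : R) : Prop :=
  forall x : R, nmul R (pad [:: x] one) = x.

Record hyperideal (I : set R) : Prop := Hyperideal {
  hi_nonempty : I !=set0;
  hi_hadd : hlift (hadd R) (fun=> I) `<=` I;
  hi_opp : forall x, I x -> I (kopp R x);
  hi_nmul : forall (a : 'I_n -> R) (i : 'I_n),
    glift (nmul R) [eta set1 \o a with i |-> I] `<=` I
}.

Definition proper_hyperideal (I : set R) : Prop := hyperideal I /\ I <> setT.

Definition prime_hyperideal (Q : set R) : Prop :=
  proper_hyperideal Q /\
  forall a : 'I_n -> R, Q (nmul R a) -> exists i, Q (a i).

Definition radical (I : set R) : set R :=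
  \bigcap_(Q in [set Q | prime_hyperideal Q /\ I `<=` Q]) Q.

Variable one : R.

Definition sq_primary (P : set R) : Prop :=
  proper_hyperideal P /\
  forall r : 'I_n -> R, P (nmul R r) ->
    exists i, P (nmul R (pad [:: r i; r i] one)) \/
              radical P (nmul R [eta r with i |-> one]).

Definition wsq_primary (P : set R) : Prop :=
  proper_hyperideal P /\
  forall r : 'I_n -> R, kzero R <> nmul R r -> P (nmul R r) ->
    exists i, P (nmul R (pad [:: r i; r i] one)) \/
              radical P (nmul R [eta r with i |-> one]).

End Krasner.

Section Product.
Context {m n : nat}.
Variables R1 R2 : krasner m n.
Local Notation R := (R1 * R2)%type.

Definition prod_hadd (z : 'I_m -> R) : set R :=
  hadd R1 (fst \o z) `*` hadd R2 (snd \o z).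

Definition prod_nmul (z : 'I_n -> R) : R :=
  (nmul R1 (fst \o z), nmul R2 (snd \o z)).

Definition prod_kzero : R := (kzero R1, kzero R2).

Definition prod_kopp (z : R) : R := (kopp R1 z.1, kopp R2 z.2).

Lemma hlift_prod (A : 'I_m -> set R1) (B : 'I_m -> set R2) :
  hlift prod_hadd (fun k => A k `*` B k) =
  hlift (hadd R1) A `*` hlift (hadd R2) B.
Proof.
apply/seteqP; split=> [[u v] [a aAB [/= fu fv]]|[u v] [[a aA fu] [b bB fv]]].
  by split; [exists (fst \o a) | exists (snd \o a)] => // k; have [] := aAB k.
exists (fun k => (a k, b k)); last by [].
by move=> k; split; [exact: aA | exact: bB].
Qed.

Lemma glift_prod (A : 'I_n -> set R1) (B : 'I_n -> set R2) :
  glift prod_nmul (fun k => A k `*` B k) =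
  glift (nmul R1) A `*` glift (nmul R2) B.
Proof.
apply/seteqP; split=> [[u v] [a aAB [<- <-]]|[u v] [[a aA /= <-] [b bB /= <-]]].
  by split; [exists (fst \o a) | exists (snd \o a)] => // k; have [] := aAB k.
exists (fun k => (a k, b k)); last by [].
by move=> k; split; [exact: aA | exact: bB].
Qed.

Lemma set1_prod (z : R) : [set z] = [set z.1] `*` [set z.2].
Proof.
by case: z => a b; apply/seteqP; split=> [[u v] [-> ->]|[u v] /= [-> ->]].
Qed.

Lemma prod_set_inj (A : set R1) (B : set R2) (z : R) :
  A `*` B = [set z] -> A = [set z.1] /\ B = [set z.2].
Proof.
move=> E; have [Az Bz] : (A `*` B) z by rewrite E.
split; apply/seteqP; split=> [u uA|_ ->] //.
  have : (A `*` B) (u, z.2) by [].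
  by rewrite E => <-.
have : (A `*` B) (z.1, u) by [].
by rewrite E => <-.
Qed.

Lemma padfst p (s : seq R) d : fst \o @pad _ p s d = pad (map fst s) d.1.
Proof.
by apply/funext => k; rewrite /pad /=; elim: s (val k) => [|x s IH] [|j] //=.
Qed.

Lemma padsnd p (s : seq R) d : snd \o @pad _ p s d = pad (map snd s) d.2.
Proof.
by apply/funext => k; rewrite /pad /=; elim: s (val k) => [|x s IH] [|j] //=.
Qed.

Lemma comp_splice p (S T : Type) (h : S -> T) x (i : 'I_p) y :
  h \o splice x i y = splice (h \o x) i (h y).
Proof. by apply/funext => k; rewrite /splice /=; case: ifP => _ //; case: ifP. Qed.

Lemma comp_move p (S T : Type) (h : S -> T) y x (i : 'I_p) :
  h \o move_front y x i = move_front (h y) (h \o x) i.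
Proof. by apply/funext => k; rewrite /move_front /=; case: ifP => _ //; case: ifP. Qed.

Lemma comp_with p (S T : Type) (h : S -> T) x (i : 'I_p) y :
  h \o [eta x with i |-> y] = [eta h \o x with i |-> h y].
Proof. by apply/funext => k /=; case: ifP. Qed.

Lemma prod_hypergroup : canonical_hypergroup prod_hadd prod_kzero prod_kopp.
Proof.
have [[ne1 as1 cm1 [z1 u1] op1 rv1] _ _ _] := krasnerP R1.
have [[ne2 as2 cm2 [z2 u2] op2 rv2] _ _ _] := krasnerP R2.
split.
- move=> x; have [a fa] := ne1 (fst \o x); have [b fb] := ne2 (snd \o x).
  by exists (a, b); split.
- have aux (x : nat -> R) (i : 'I_m) :
    hlift prod_hadd (splice (set1 \o x) i (prod_hadd (fun l => x (i + l)%N))) =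
    hlift (hadd R1) (splice (set1 \o (fst \o x)) i
      (hadd R1 (fun l => (fst \o x) (i + l)%N))) `*`
    hlift (hadd R2) (splice (set1 \o (snd \o x)) i
      (hadd R2 (fun l => (snd \o x) (i + l)%N))).
    rewrite -hlift_prod; congr hlift; apply/funext => k.
    by rewrite /splice /=; case: ifP => _; [|case: ifP => _];
       rewrite ?set1_prod.
  by move=> x i j; rewrite !aux (as1 _ i j) (as2 _ i j).
- by move=> x s; rewrite /prod_hadd -(cm1 (fst \o x) s) -(cm2 (snd \o x) s).
- split=> [x|[e1 e2] eP].
    by rewrite /prod_hadd padfst padsnd /= z1 z2 -set1_prod.
  by congr pair; [apply: u1 => x; have := eP (x, kzero R2)
                 |apply: u2 => x; have := eP (kzero R1, x)];
     rewrite /prod_hadd padfst padsnd => /prod_set_inj[].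
- move=> [x1 x2]; have [p1 q1] := op1 x1; have [p2 q2] := op2 x2.
  split=> [|[y1 y2]]; rewrite /prod_hadd padfst padsnd; first by split.
  by move=> [/= /q1 <- /q2 <-].
- move=> x a i [/rv1-/(_ i) h1 /rv2-/(_ i) h2].
  by split; rewrite comp_move.
Qed.

Lemma prod_is_krasner : is_krasner prod_hadd prod_nmul prod_kzero prod_kopp.
Proof.
have [_ as1 ds1 ab1] := krasnerP R1; have [_ as2 ds2 ab2] := krasnerP R2.
split; first exact: prod_hypergroup.
- move=> x i j; rewrite /prod_nmul !comp_splice /=.
  by congr pair; [apply: (as1 (fst \o x)) | apply: (as2 (snd \o x))].
- move=> a i x; rewrite {2}/prod_hadd.
  transitivity (glift prod_nmul (fun k =>
     [eta set1 \o (fst \o a) with i |-> hadd R1 (fst \o x)] k `*`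
     [eta set1 \o (snd \o a) with i |-> hadd R2 (snd \o x)] k)).
    by congr glift; apply/funext => k /=; case: ifP => _; rewrite ?set1_prod.
  rewrite glift_prod ds1 ds2; congr (hadd R1 _ `*` hadd R2 _);
    by apply/funext => k; rewrite /prod_nmul /= comp_with.
- by move=> a i; rewrite /prod_nmul !comp_with /= ab1 ab2.
Qed.

Definition prod_krasner : krasner m n := Krasner prod_is_krasner.

End Product.

(* Main.v *)
Require Import Defs.
From mathcomp Require Import all_boot all_fingroup.
From mathcomp Require Import boolp classical_sets.

(** Membership in a cylinder [P1 `*` setT] ignores the second coordinate, so
    the theorem amounts to the fact that every ingredient of the two
    definitions does too.  The only ingredient that is not read off coordinates
    is the radical, an intersection over all primes of the product.  A
    hyperideal [Q] of the product that contains the axis [0 x R2] is a cylinder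
    over a hyperideal of [R1]: if [(a, b)] is in [Q], then so is
    [(a, 0) = (a, b) * (1, 0)], hence also [(a, c)], which lies in the sum of
    [(a, 0)] and [(0, c)] ([axis_sub_cylinder]).  A cylinder is prime exactly
    when its base is ([prime_hyperideal_cylinder]), so the radical of a cylinder
    is the cylinder over the radical ([radical_cylinder]), and a cylinder is
    sq-primary exactly when its base is ([sq_primary_cylinder]).

    The weak condition on [P1 `*` setT] implies the strong one because a tuple
    with product zero can be modified without changing the conclusion: setting
    all its second coordinates to [one2] makes its product
    [(nmul R1 a, one2)], which is nonzero
    ([wsq_primary_cylinder_sq_primary]). *)

Set Implicit Arguments.
Unset Strict Implicit.
Unset Printing Implicit Defensive.

Local Open Scope classical_set_scope.

(** * Hyperideals and neutral elements *)

Section Hyperideals.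
Context {m n : nat}.
Variable R : krasner m n.

(** The liftings of the operations to sets are convenient for stating the
    axioms; this form with elements is the one that proofs use. *)
Lemma hyperidealP (I : set R) :
  hyperideal I <->
  [/\ I !=set0,
      forall x : 'I_m -> R, (forall k, I (x k)) -> hadd R x `<=` I,
      forall x, I x -> I (kopp R x) &
      forall (a : 'I_n -> R) i, I (a i) -> I (nmul R a)].
Proof.
split=> [[I0 Iadd Iopp Imul]|[I0 Iadd Iopp Imul]]; split=> //.
- by move=> x Ix y xy; apply: Iadd; exists x.
- move=> a i Iai; apply: (Imul a i); exists a => // k /=.
  by case: eqP => [->|].
- by move=> y [x Ix xy]; apply: Iadd xy.
- move=> a i _ [x xa <-]; apply: (Imul x i).
  by have := xa i; rewrite /= eqxx.
Qed.

Lemma hyperideal_hadd (I : set R) (x : 'I_m -> R) :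
  hyperideal I -> (forall k, I (x k)) -> hadd R x `<=` I.
Proof. by move=> /hyperidealP[_ + _ _]; apply. Qed.

Lemma hyperideal_nmul (I : set R) (a : 'I_n -> R) (i : 'I_n) :
  hyperideal I -> I (a i) -> I (nmul R a).
Proof. by move=> /hyperidealP[_ _ _]; apply. Qed.

(** Two positions are used: one holds an element of [I], another absorbs. *)
Lemma hyperideal_kzero (I : set R) : (1 < n)%N -> hyperideal I -> I (kzero R).
Proof.
move=> n1 hI; have [x Ix] := hi_nonempty hI.
have [_ _ _ absorb] := krasnerP R.
pose i0 := Ordinal (ltnW n1); pose i1 := Ordinal n1.
by rewrite -(absorb (fun=> x) i1); apply: (hyperideal_nmul (i := i0)) => //.
Qed.

Lemma scalar_identity_nmul1 (one : R) :
  scalar_identity one -> nmul R (fun=> one) = one.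
Proof.
move=> one_id; rewrite -[RHS]one_id; congr nmul.
by apply/funext => k; rewrite /pad; case: (val k) => [|j] //=; rewrite nth_nil.
Qed.

Lemma hadd_x0 (x : R) : hadd R (pad [:: x] (kzero R)) = [set x].
Proof. by have [[_ _ _ [z0 _] _ _] _ _ _] := krasnerP R; apply: z0. Qed.

(** Commutativity is needed because the axiom on zero speaks of the first
    position only. *)
Lemma hadd_0x (x : R) :
  (1 < m)%N -> hadd R (pad [:: kzero R; x] (kzero R)) = [set x].
Proof.
move=> m1; have [[_ _ comm _ _ _] _ _ _] := krasnerP R.
pose i0 := Ordinal (ltnW m1); pose i1 := Ordinal m1.
rewrite -hadd_x0 -(comm _ (tperm i0 i1)); congr hadd.
apply/funext => k; rewrite /pad /=.
case: tpermP => [->|->|/eqP k0 /eqP k1] //=.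
by case: k k0 k1 => [[|[|j]] //= ltj] _ _; rewrite !nth_nil.
Qed.

Lemma sq_primary_wsq_primary (one : R) (Q : set R) :
  sq_primary one Q -> wsq_primary one Q.
Proof. by move=> [hQ sqQ]; split=> // r _; apply: sqQ. Qed.

End Hyperideals.

(** * Cylinders in a product *)

Section Cylinders.
Context {m n : nat}.
Hypotheses (m1 : (1 < m)%N) (n1 : (1 < n)%N).
Variables R1 R2 : krasner m n.
Variables (one1 : R1) (one2 : R2).
Hypotheses (one1_id : scalar_identity one1) (one2_id : scalar_identity one2).
Local Notation R := (prod_krasner R1 R2).
Implicit Types (I P : set R1) (Q : set R).

(** The type annotation makes [I `*` setT] a subset of the carrier of the product
    hyperring, where the plain expression is a subset of a product of types. *)
Definition cylinder I : set R := I `*` [set: R2].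

Lemma cylinderE I (z : R) : cylinder I z = I z.1.
Proof. by apply/propext; split=> [[]|]. Qed.

Lemma cylinder_nmul I (r : 'I_n -> R) :
  cylinder I (nmul R r) = I (nmul R1 (fst \o r)).
Proof. by rewrite cylinderE. Qed.

Lemma hyperideal_cylinder I : hyperideal (cylinder I) <-> hyperideal I.
Proof.
have [[ne2 _ _ _ _ _] _ _ _] := krasnerP R2.
split=> /hyperidealP[[z Iz] Iadd Iopp Imul]; apply/hyperidealP; split.
- by exists z.1; rewrite -cylinderE.
- move=> x Ix y xy; have [w fw] := ne2 (fun=> kzero R2).
  rewrite -[y]/(y, w).1 -cylinderE.
  apply: (Iadd (fun k => (x k, kzero R2))); last exact: conj xy fw.
  by move=> k; rewrite cylinderE; apply: Ix.
- by move=> x Ix; have [] := Iopp (x, kzero R2).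
- move=> a i Iai; have := Imul (fun k => (a k, kzero R2)) i.
  by rewrite cylinder_nmul cylinderE; apply.
- by exists (z, kzero R2).
- move=> x Ix y [xy _]; rewrite cylinderE; apply: Iadd xy => k /=.
  by rewrite -cylinderE.
- by move=> x; rewrite !cylinderE; apply: Iopp.
- by move=> a i; rewrite cylinder_nmul cylinderE; apply: Imul.
Qed.

Lemma proper_hyperideal_cylinder I :
  proper_hyperideal (cylinder I) <-> proper_hyperideal I.
Proof.
rewrite /proper_hyperideal hyperideal_cylinder.
split=> -[hI IT]; split=> // eqT; apply: IT.
  by rewrite /cylinder eqT setXTT.
apply/seteqP; split=> // x _; rewrite -[x]/(x, kzero R2).1 -cylinderE.
by rewrite eqT.
Qed.

Lemma prime_hyperideal_cylinder P :
  prime_hyperideal (cylinder P) <-> prime_hyperideal P.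
Proof.
rewrite /prime_hyperideal proper_hyperideal_cylinder.
split=> -[hP primeP]; split=> // a.
  move=> Pa; have [|i] := primeP (fun k => (a k, kzero R2)).
    by rewrite cylinder_nmul.
  by rewrite cylinderE; exists i.
by rewrite cylinder_nmul => /primeP[i Pi]; exists i; rewrite cylinderE.
Qed.

Lemma axis_sub_cylinder Q :
  hyperideal Q -> (forall b, Q (kzero R1, b)) ->
  Q = cylinder [set a | Q (a, kzero R2)].
Proof.
move=> hQ Q0.
have [_ _ _ absorb2] := krasnerP R2.
pose i0 := Ordinal (ltnW n1); pose i1 := Ordinal n1.
apply/seteqP; split=> [[a b] Qab|[a b]]; rewrite cylinderE /=.
  (* The product of [(a, b)], [(1, 0)] and copies of [(1, 1)]. *)
  pose u (k : 'I_n) : R :=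
    (pad [:: a] one1 k, [eta pad [:: b] one2 with i1 |-> kzero R2] k).
  have -> : (a, kzero R2) = nmul R u.
    by rewrite -[a in LHS]one1_id -(absorb2 (pad [:: b] one2) i1).
  exact: (hyperideal_nmul (i := i0)).
move=> Qa0.
(* The sum of [(a, 0)], [(0, b)] and copies of zero, all of them in [Q]. *)
pose v (k : 'I_m) : R :=
  (pad [:: a] (kzero R1) k, pad [:: kzero R2; b] (kzero R2) k).
apply: (hyperideal_hadd (x := v) hQ).
  by case=> [[|j] ltj]; rewrite /v /pad //= nth_nil.
split=> /=.
  by rewrite -[fst \o v]/(pad [:: a] (kzero R1)) hadd_x0.
by rewrite -[snd \o v]/(pad [:: kzero R2; b] (kzero R2)) hadd_0x.
Qed.

(** Primes of the product that contain the cylinder over [I] contain the axis,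
    since [I] contains zero, so they are exactly the cylinders over the primes of
    [R1] that contain [I]. *)
Lemma radical_cylinder I :
  hyperideal I -> radical (cylinder I) = cylinder (radical I).
Proof.
move=> hI; apply/seteqP; split=> z; rewrite cylinderE.
  move=> radz P [primeP IP]; rewrite -cylinderE; apply: radz; split.
    by rewrite prime_hyperideal_cylinder.
  by move=> x; rewrite !cylinderE; apply: IP.
move=> radz Q [primeQ IQ].
have Q0 b : Q (kzero R1, b).
  by apply: IQ; rewrite cylinderE; apply: hyperideal_kzero.
have hQ := primeQ.1.1.
have eqQ := axis_sub_cylinder hQ Q0.
rewrite eqQ cylinderE; apply: radz; split.
  by rewrite -prime_hyperideal_cylinder -eqQ.
by move=> x Ix; apply: IQ; rewrite cylinderE.
Qed.

(** The disjunction that concludes both primary conditions depends only on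
    the first coordinates of the tuple. *)
Lemma cylinder_conclusion P (r : 'I_n -> R) (i : 'I_n) :
  hyperideal P ->
  (cylinder P (nmul R (pad [:: r i; r i] (one1, one2))) \/
   radical (cylinder P) (nmul R [eta r with i |-> (one1, one2)])) <->
  (P (nmul R1 (pad [:: (fst \o r) i; (fst \o r) i] one1)) \/
   radical P (nmul R1 [eta fst \o r with i |-> one1])).
Proof.
move=> hP; rewrite radical_cylinder // !cylinder_nmul.
by rewrite padfst comp_with.
Qed.

Lemma sq_primary_cylinder P :
  sq_primary ((one1, one2) : R) (cylinder P) <-> sq_primary one1 P.
Proof.
rewrite /sq_primary proper_hyperideal_cylinder.
split=> -[hP sqP]; split=> // r Pr.
  have [|i] := sqP (fun k => (r k, one2)); first by rewrite cylinder_nmul.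
  by move/(cylinder_conclusion _ _ hP.1); exists i.
have [|i concl] := sqP (fst \o r); first by rewrite -cylinder_nmul.
by exists i; apply/(cylinder_conclusion _ _ hP.1).
Qed.

(** Completing a tuple of [R1] with second coordinates [one2], rather than with
    zeros, makes the product nonzero even when its first coordinate vanishes. *)
Lemma wsq_primary_cylinder_sq_primary P :
  one2 <> kzero R2 ->
  wsq_primary ((one1, one2) : R) (cylinder P) -> sq_primary one1 P.
Proof.
move=> one2_neq0 [/proper_hyperideal_cylinder hP wsqP]; split=> // r Pr.
have [||i] := wsqP (fun k => (r k, one2)); last 1 first.
- by move/(cylinder_conclusion _ _ hP.1); exists i.
- by case=> _ /esym; rewrite -[_ \o _]/(fun=> one2) scalar_identity_nmul1.
- by rewrite cylinder_nmul.
Qed.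

End Cylinders.

Theorem theorem4p15 (m n : nat) (hm : (2 <= m)%N) (hn : (2 <= n)%N)
    (R1 R2 : krasner m n)
    (hR1 : commutative_krasner R1) (hR2 : commutative_krasner R2)
    (one1 : R1) (one2 : R2)
    (h1 : scalar_identity one1) (h2 : scalar_identity one2)
    (h1n0 : one1 <> kzero R1) (h2n0 : one2 <> kzero R2)
    (P1 : set R1) (hP1 : proper_hyperideal P1) :
  [<-> @wsq_primary m n (prod_krasner R1 R2) (one1, one2) (P1 `*` [set: R2]);
       @sq_primary m n (prod_krasner R1 R2) (one1, one2) (P1 `*` [set: R2]);
       sq_primary one1 P1].
Proof.
have sqE := sq_primary_cylinder hm hn one2 h1 P1.
split=> [wsqP|]; last split=> [sqP|sqP].
- by apply/sqE; apply: wsq_primary_cylinder_sq_primary wsqP.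
- exact/sqE.
- by apply: sq_primary_wsq_primary; apply/sqE.
Qed.
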